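(* Let $A$ be a vector space with two bilinear operations $\vartriangleright,\vartriangleleft:A\otimes A\to A$, and define $x\cdot y=x\vartriangleright y+x\vartriangleleft y$ for all $x,y\in A$. Then the following conditions are equivalent. (1) $(A,\vartriangleright,\vartriangleleft)$ is an anti-dendriform algebra. (2) $(A,\cdot)$ is an associative algebra, and for all $x,y,z\in A$: $$x\vartriangleright(y\vartriangleright z)=-(x\cdot y)\vartriangleright z,\qquad (x\vartriangleleft y)\vartriangleleft z=-x\vartriangleleft(y\cdot z),\qquad (x\vartriangleright y)\vartriangleleft z=x\vartriangleright(y\vartriangleleft z).$$ (3) $(A,\cdot)$ is an associative algebra, and $(A,-L_\vartriangleright,-R_\vartriangleleft)$ is a bimodule of $(A,\cdot)$, where $L_\vartriangleright,R_\vartriangleleft:A\to \mathrm{End}_{\mathbb F}(A)$ are given by $L_\vartriangleright(x)(y)=x\vartriangleright y$ and $R_\vartriangleleft(x)(y)=y\vartriangleleft x$.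
   Context: All vector spaces are finite-dimensional over a field $\mathbb F$ of characteristic $0$. Associative algebras are not assumed to be unital. Anti-dendriform algebra: a vector space $A$ with two bilinear operations $\vartriangleright,\vartriangleleft$ such that, with $x\cdot y=x\vartriangleright y+x\vartriangleleft y$, for all $x,y,z\in A$, $$x\vartriangleright(y\vartriangleright z)=-(x\cdot y)\vartriangleright z=-x\vartriangleleft(y\cdot z)=(x\vartriangleleft y)\vartriangleleft z,\qquad (x\vartriangleright y)\vartriangleleft z=x\vartriangleright(y\vartriangleleft z).$$ Bimodule of an associative algebra $(A,\cdot)$: a triple $(V,l,r)$ with $V$ a vector space and $l,r:A\to\mathrm{End}_{\mathbb F}(V)$ linear maps such that $l(x\cdot y)v=l(x)(l(y)v)$, $r(x\cdot y)v=r(y)(r(x)v)$, $l(x)(r(y)v)=r(y)(l(x)v)$ for all $x,y\in A$, $v\in V$. *)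

(* Defs.v *)
From HB Require Import structures.
From mathcomp Require Import all_boot all_order all_algebra.

Set Implicit Arguments.
Unset Strict Implicit.
Unset Printing Implicit Defensive.

Import GRing.Theory.
Local Open Scope ring_scope.

Section Algebras.
Variables (F : fieldType) (A : vectType F).
Implicit Types rt lt op mul : {bilinear A -> A -> A}.

(* rt and lt are the operations written as a right, resp. left, triangle *)
Definition sum_op rt lt (x y : A) : A := rt x y + lt x y.

Lemma sum_op_is_bilinear rt lt : bilinear_for *:%R *:%R (sum_op rt lt).
Proof.
split=> u a x y; rewrite /sum_op /applyr /=.
  by rewrite !linearPl scalerDr addrACA.
by rewrite !linearPr scalerDr addrACA.
Qed.

HB.instance Definition _ rt lt := bilinear_isBilinear.Build F A A A *:%R *:%R
  (sum_op rt lt) (sum_op_is_bilinear rt lt).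

Definition anti_dendriform rt lt : Prop :=
  forall x y z : A,
    [/\ rt x (rt y z) = - rt (sum_op rt lt x y) z,
        - rt (sum_op rt lt x y) z = - lt x (sum_op rt lt y z),
        - lt x (sum_op rt lt y z) = lt (lt x y) z
      & lt (rt x y) z = rt x (lt y z)].

Definition assoc_algebra mul : Prop := associative mul.

Definition bimodule mul (V : vectType F) (l r : 'Hom(A, 'End(V))) : Prop :=
  forall (x y : A) (v : V),
    [/\ l (mul x y) v = l x (l y v),
        r (mul x y) v = r y (r x v)
      & l x (r y v) = r y (l x v)].

Definition Lmul op : 'Hom(A, 'End(A)) := linfun (fun x => linfun (op x)).

Definition Rmul op : 'Hom(A, 'End(A)) :=
  linfun (fun x => linfun (fun y => op y x)).

(* linfun f is only specified when f is linear, as is the case in Lmul, Rmul *)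
Lemma LmulE op x y : Lmul op x y = op x y.
Proof.
pose f (x : A) : 'End(A) := linfun (op x).
have f_lin : linear f.
  move=> a u v; apply/lfunP=> z.
  by rewrite add_lfunE scale_lfunE !lfunE /= linearPl.
pose fM := GRing.isLinear.Build F A 'End(A) *:%R f f_lin.
pose fL : {linear A -> 'End(A)} := HB.pack f fM.
by rewrite /Lmul (lfunE fL) /= /f lfunE.
Qed.

Lemma RmulE op x y : Rmul op x y = op y x.
Proof.
pose f (x : A) : 'End(A) := linfun (applyr op x).
have f_lin : linear f.
  move=> a u v; apply/lfunP=> z.
  by rewrite add_lfunE scale_lfunE !lfunE /= /applyr linearPr.
pose fM := GRing.isLinear.Build F A 'End(A) *:%R f f_lin.
pose fL : {linear A -> 'End(A)} := HB.pack f fM.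
by rewrite /Rmul (lfunE fL) /= /f lfunE.
Qed.

End Algebras.

(* Main.v *)
Require Import Defs.
From mathcomp Require Import all_boot all_order all_algebra.
Import GRing.Theory.
Local Open Scope ring_scope.

(** The three identities [twisted_identities] leave only one of the
    anti-dendriform equations undecided, [rt x (rt y z) = - lt x (y . z)], where
    [.] is the sum of the two operations; and that one is associativity in
    disguise.  Expanding both bracketings of a triple product, the mixed terms
    [rt x (lt y z)] and [lt (rt x y) z] cancel and the other four terms pair up:
    [x . (y . z) - (x . y) . z] is twice [rt x (rt y z) + lt x (y . z)]
    ([associator_sum_op]).  It therefore vanishes when the equation holds, and
    only then, since 2 is invertible in characteristic 0 ([assoc_sum_opE]).

    The bimodule condition is a transcription of the same three identities
    ([bimodule_sum_opP]): in the module axioms for [- Lmul rt] and [- Rmul lt],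
    one sign remains on a side with a single action and two cancel on a side
    with a composite, which gives the minus signs of the first two identities
    and none in the third. *)

Section AntiDendriform.
Variables (F : fieldType) (A : vectType F) (rt lt : {bilinear A -> A -> A}).

Definition twisted_identities : Prop := forall x y z : A,
  [/\ rt x (rt y z) = - rt (sum_op rt lt x y) z,
      lt (lt x y) z = - lt x (sum_op rt lt y z)
    & lt (rt x y) z = rt x (lt y z)].

(** The four terms left after cancelling the mixed ones are two copies each of
    [rt x (rt y z)] and [lt x (y . z)]: each of the first two identities turns
    a term of the subtracted bracketing into the opposite of a term of the
    other one. *)
Lemma associator_sum_op : twisted_identities -> forall x y z : A,
  sum_op rt lt x (sum_op rt lt y z) - sum_op rt lt (sum_op rt lt x y) z =
  (rt x (rt y z) + lt x (sum_op rt lt y z)) *+ 2.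
Proof.
move=> twA x y z; have [rtA ltA mixA] := twA x y z.
have ->: sum_op rt lt x (sum_op rt lt y z) =
         rt x (lt y z) + (rt x (rt y z) + lt x (sum_op rt lt y z)).
  by rewrite {1}/sum_op {1}/sum_op linearDr addrA [rt x (lt y z) + _]addrC.
have ->: sum_op rt lt (sum_op rt lt x y) z =
         rt x (lt y z) - (rt x (rt y z) + lt x (sum_op rt lt y z)).
  by rewrite rtA opprD opprK -ltA -mixA addrCA -linearDl.
by rewrite [rt x (lt y z) + _ in LHS]addrC addrKA opprK mulr2n.
Qed.

Lemma assoc_sum_opE : [pchar F] =i pred0 -> twisted_identities ->
  assoc_algebra (sum_op rt lt) <->
  forall x y z : A, rt x (rt y z) = - lt x (sum_op rt lt y z).
Proof.
move=> F_char0 twA; split=> [mulA | rtltA] x y z.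
  have /eqP := associator_sum_op twA x y z.
  rewrite mulA subrr eq_sym -scaler_nat scaler_eq0.
  by rewrite ((pcharf0P F).1 F_char0) /= addr_eq0 => /eqP.
by apply/subr0_eq; rewrite (associator_sum_op twA) rtltA addNr mul0rn.
Qed.

Lemma anti_dendriformP : [pchar F] =i pred0 ->
  anti_dendriform rt lt <-> assoc_algebra (sum_op rt lt) /\ twisted_identities.
Proof.
move=> F_char0; split=> [adA | [mulA twA] x y z].
  have twA : twisted_identities.
    by move=> x y z; have [rtA _ ltA mixA] := adA x y z; split.
  split=> //; apply/(assoc_sum_opE F_char0 twA) => x y z.
  by have [-> ->] := adA x y z.
have rtltA := (assoc_sum_opE F_char0 twA).1 mulA x y z.
by have [rtA ltA mixA] := twA x y z; split=> //; rewrite -rtA.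
Qed.

(** The module element is the last argument of the left action but sits first
    in the second identity and in the middle of the third, hence the different
    orders of the variables below. *)
Lemma bimodule_sum_opP :
  bimodule (sum_op rt lt) (- Lmul rt) (- Rmul lt) <-> twisted_identities.
Proof.
have LE x v : (- Lmul rt) x v = - rt x v.
  by rewrite !opp_lfunE LmulE.
have RE x v : (- Rmul lt) x v = - lt v x.
  by rewrite !opp_lfunE RmulE.
split=> [bimA x y z | twA x y v].
  have [lA _ _] := bimA x y z; have [_ rA _] := bimA y z x.
  have [_ _ lrA] := bimA x z y; move: lA rA lrA.
  by rewrite !LE !RE !linearNr !linearNl !opprK => -> -> ->.
have [rtA _ _] := twA x y v; have [_ ltA _] := twA v x y.
have [_ _ mixA] := twA x v y.
by rewrite !LE !RE !linearNr !linearNl !opprK rtA ltA mixA.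
Qed.

End AntiDendriform.

Theorem proposition2p12 (F : fieldType) (F_char0 : [pchar F] =i pred0)
    (A : vectType F) (rt lt : {bilinear A -> A -> A}) :
  [<-> anti_dendriform rt lt;
       assoc_algebra (sum_op rt lt) /\
       (forall x y z : A,
         [/\ rt x (rt y z) = - rt (sum_op rt lt x y) z,
             lt (lt x y) z = - lt x (sum_op rt lt y z)
           & lt (rt x y) z = rt x (lt y z)]);
       assoc_algebra (sum_op rt lt) /\
       bimodule (sum_op rt lt) (- Lmul rt) (- Rmul lt)].
Proof.
tfae=> [/(anti_dendriformP _ _ _ _ F_char0) // | [mulA twA] | [mulA bimA]].
  by split=> //; apply/bimodule_sum_opP.
by apply/(anti_dendriformP _ _ _ _ F_char0); split=> //; apply/bimodule_sum_opP.
Qed.
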